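(* Let $G$ be a group and $k$ a commutative ring. Let $V$ be an $\mathrm{FI}_G$-module over $k$ which is generated in finite degree. Then $V$ is degree-wise coherent if and only if $\operatorname{td}(V) < \infty$.
   Context: $\mathrm{FI}_G$ is the category whose objects are the sets $[n]=\{1,\ldots,n\}$, $n \ge 0$, and whose morphisms $(f,g):[n]\to[m]$ are pairs of an injection $f:[n]\to[m]$ and an arbitrary map of sets $g:[n]\to G$; composition is $(f,g)\circ(h,g') = (f\circ h, g'')$ with $g''(x) = g'(x)\cdot g(h(x))$. Write $G_r = \operatorname{End}_{\mathrm{FI}_G}([r]) = \mathfrak{S}_r \wr G$. An $\mathrm{FI}_G$-module over $k$ is a functor $V:\mathrm{FI}_G \to k\text{-Mod}$; write $V_n = V([n])$ and $(f,g)_\ast = V(f,g)$; when $n<m$ these maps are called transition maps. The degree of $V$ is $\deg(V)=\sup\{n \mid V_n \neq 0\}$, with $\sup\emptyset = -\infty$. For a $kG_r$-module $W$, the free module $M(W)$ has $M(W)_n = k[\operatorname{Hom}_{\mathrm{FI}_G}([r],[n])]\otimes_{kG_r} W$, with induced maps acting by composition on the first factor; it is said to be generated in degree $r$. A free module is a direct sum of such modules, and its generating degree is the supremum of the degrees $r$ of its summands. $V$ is generated in finite degree if there is $N$ such that no proper submodule of $V$ contains $\bigsqcup_{n\le N} V_n$. $V$ is degree-wise coherent if there is an exact sequence $0\to K\to F\to V\to 0$ with $F$ a free module of finite generating degree and $K$ generated in finite degree. An element $v\in V_n$ is torsion if $(f,g)_\ast(v)=0$ for some morphism $(f,g):[n]\to[m]$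 of $\mathrm{FI}_G$. Let $V_T$ denote the maximal torsion submodule of $V$ (the submodule of all torsion elements). The torsion degree is $\operatorname{td}(V) = \deg(V_T)$. *)

(* Defs.v *)
From HB Require Import structures.
From mathcomp Require Import all_boot all_algebra.

Set Implicit Arguments.
Unset Strict Implicit.
Unset Printing Implicit Defensive.

Import GRing.Theory.
Local Open Scope ring_scope.

Section FIG.
Variable G : groupType.

(* Morphisms [n] -> [m] of FI_G : pairs (f, g), f : [n] -> [m] injective,
   g : [n] -> G arbitrary. We use [n] = 'I_n (= {0,...,n-1}). *)
Record homG (n m : nat) := HomG {
  hf : 'I_n -> 'I_m;
  hf_inj : injective hf;
  hg : 'I_n -> G
}.

Definition heq n m (a b : homG n m) : Prop := hf a =1 hf b /\ hg a =1 hg b.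

Definition hid (n : nat) : homG n n :=
  @HomG n n id (@inj_id _) (fun _ => 1%g).

Definition hcomp n m l (a : homG m l) (b : homG n m) : homG n l :=
  @HomG n l (hf a \o hf b) (inj_comp (@hf_inj _ _ a) (@hf_inj _ _ b))
    (fun x => (hg b x * hg a (hf b x))%g).

Variable k : comPzRingType.

Definition klinear (U W : lmodType k) (f : U -> W) : Prop :=
  forall (c : k) (x y : U), f (c *: x + y) = c *: f x + f y.

Record fimod := FIMod {
  Vsp : nat -> lmodType k;
  act : forall n m, homG n m -> Vsp n -> Vsp m;
  act_lin : forall n m (a : homG n m), klinear (act a);
  act_ext : forall n m (a b : homG n m), heq a b -> act a =1 act b;
  act_id : forall n (x : Vsp n), act (hid n) x = x;
  act_comp : forall n m l (a : homG m l) (b : homG n m) (x : Vsp n),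
      act (hcomp a b) x = act a (act b x)
}.

Definition is_fimorph (V W : fimod) (phi : forall n, Vsp V n -> Vsp W n) : Prop :=
  (forall n, klinear (phi n)) /\
  (forall n m (a : homG n m) (x : Vsp V n), phi m (act a x) = act a (phi n x)).

Definition is_submodule (V : fimod) (W : forall n, Vsp V n -> Prop) : Prop :=
  (forall n, W n 0) /\
  (forall n (c : k) (x y : Vsp V n), W n x -> W n y -> W n (c *: x + y)) /\
  (forall n m (a : homG n m) (x : Vsp V n), W n x -> W m (act a x)).

Definition gen_fin_deg (V : fimod) : Prop :=
  exists N : nat, forall W : forall n, Vsp V n -> Prop,
    is_submodule W -> (forall n (x : Vsp V n), (n <= N)%N -> W n x) ->
    forall n (x : Vsp V n), W n x.

Definition is_torsion (V : fimod) n (v : Vsp V n) : Prop :=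
  exists m (a : homG n m), act a v = 0.

Definition torsion_part (V : fimod) : forall n, Vsp V n -> Prop :=
  fun n v => is_torsion v.

(* deg(W) = sup {n | W_n <> 0} < oo  (with sup of the empty set = -oo). *)
Definition deg_finite (V : fimod) (W : forall n, Vsp V n -> Prop) : Prop :=
  exists N : nat, forall n, (exists v : Vsp V n, W n v /\ v <> 0) -> (n <= N)%N.

Definition td_finite (V : fimod) : Prop := @deg_finite V (@torsion_part V).

(* A kG_r-module, G_r = End_{FI_G}([r]) acting (on the left) k-linearly. *)
Record grmod (r : nat) := GRMod {
  Wsp : lmodType k;
  ract : homG r r -> Wsp -> Wsp;
  ract_lin : forall a, klinear (ract a);
  ract_ext : forall a b, heq a b -> ract a =1 ract b;
  ract_id : forall x, ract (hid r) x = x;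
  ract_comp : forall (a b : homG r r) x, ract (hcomp a b) x = ract a (ract b x)
}.

Definition grlinear r (W : grmod r) (V : fimod) (f : Wsp W -> Vsp V r) : Prop :=
  klinear f /\ forall (a : homG r r) (w : Wsp W), f (ract a w) = act a (f w).

(* F is a free FI_G-module of generating degree <= d, i.e. F is (isomorphic to)
   a direct sum of free modules M(W_i) generated in degrees r_i <= d.
   The module M(W_i) = k[Hom([r_i], -)] (x)_{kG_{r_i}} W_i, and direct sums,
   are characterised by their universal property: morphisms F -> U correspond
   bijectively to families of kG_{r_i}-linear maps W_i -> U_{r_i}, via
   restriction along the canonical maps iota_i : W_i -> F_{r_i}. *)
Definition free_gen_le (F : fimod) (d : nat) : Prop :=
  exists (I : Type) (r : I -> nat) (W : forall i, grmod (r i))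
         (iota : forall i, Wsp (W i) -> Vsp F (r i)),
    (forall i, (r i <= d)%N) /\
    (forall i, grlinear (iota i)) /\
    (forall (U : fimod) (phi : forall i, Wsp (W i) -> Vsp U (r i)),
       (forall i, grlinear (phi i)) ->
       exists Phi : forall n, Vsp F n -> Vsp U n,
         is_fimorph Phi /\ (forall i w, Phi (r i) (iota i w) = phi i w) /\
         (forall Psi : forall n, Vsp F n -> Vsp U n,
            is_fimorph Psi -> (forall i w, Psi (r i) (iota i w) = phi i w) ->
            forall n x, Psi n x = Phi n x)).

Definition degwise_coherent (V : fimod) : Prop :=
  exists (F K : fimod) (i : forall n, Vsp K n -> Vsp F n)
         (p : forall n, Vsp F n -> Vsp V n) (d : nat),
    free_gen_le F d /\ gen_fin_deg K /\
    is_fimorph i /\ is_fimorph p /\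
    (forall n, injective (i n)) /\
    (forall n (y : Vsp V n), exists x, p n x = y) /\
    (forall n (y : Vsp F n), p n y = 0 <-> exists x, i n x = y).

End FIG.

(* Main.v *)
From HB Require Import structures.
Require Import Defs.
From mathcomp Require Import all_boot all_algebra.
From mathcomp Require Import boolp.

(** Everything rests on one fact: if [X] is generated in finite degree and [Y] is
    a submodule such that [X / Y] has finite torsion degree, then [Y] is generated
    in finite degree.  After a shift [X / Y] is torsion-free, and one inducts on
    the generation degree [d] of [X].  Write [y] in [Y] as a sum of elements [z_A]
    supported on subsets [A] of size at most [d].  For [#|A| = d], the alternating
    sum of all ways of moving points of [A] to fresh positions kills every term of
    [y] but [z_A]; the result lies in [Y] and, by saturation, already in degree
    [2d].  Moving the fresh points into a fixed block of [d] points then rewrites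
    [z_A] by terms meeting that block, and these live in a submodule of the [d]-th
    shift of [X] that is generated in degrees below [d].

    If [td V] is finite, the fact applies to the kernel of the free cover of [V]
    by [V_0, ..., V_N].  Conversely, let [V = F / K] with [F] free, hence
    torsion-free, and [K] generated in finite degree.  The elements of the shift
    of [K] that are unaffected, inside [F], by moving the extra point form a
    submodule with torsion-free quotient, so it is generated in some degree [R];
    above degree [R] the extra point of such an element can be moved to an unused
    position, so they all come from [K], and [F / K] has no torsion above [R]. *)

Set Implicit Arguments.
Unset Strict Implicit.
Unset Printing Implicit Defensive.

Import GRing.Theory.
Local Open Scope ring_scope.

(** * Morphisms of FI_G *)

Section Homs.
Variable G : groupType.
Local Notation hom := (homG G).

Lemma homG_eq n m (a b : hom n m) : hf a =1 hf b -> hg a =1 hg b -> a = b.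
Proof.
case: a b => f fi g [f' fi' g'] /= /funext ef /funext eg.
by move: fi fi'; rewrite ef eg => fi fi'; rewrite (Prop_irrelevance fi fi').
Qed.

Lemma homG_leq n m (a : hom n m) : (n <= m)%N.
Proof. by have := leq_card _ (@hf_inj _ _ _ a); rewrite !card_ord. Qed.

Lemma hcompA n m l p (a : hom l p) (b : hom m l) (c : hom n m) :
  hcomp a (hcomp b c) = hcomp (hcomp a b) c.
Proof. by apply: homG_eq => x //=; rewrite mulgA. Qed.

Lemma hcomp1h n m (a : hom n m) : hcomp (hid G m) a = a.
Proof. by apply: homG_eq => x //=; rewrite mulg1. Qed.

Lemma hcomph1 n m (a : hom n m) : hcomp a (hid G n) = a.
Proof. by apply: homG_eq => x //=; rewrite mul1g. Qed.

Lemma hcompI n m l (a : hom m l) : injective (@hcomp G n m l a).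
Proof.
move=> b c e; have ef : hf b =1 hf c.
  by move=> x; apply: (@hf_inj _ _ _ a); apply: (congr1 (fun h => hf h x) e).
apply: homG_eq => // x; have /= := congr1 (fun h => hg h x) e.
by rewrite ef => /mulIg.
Qed.

(** The pointwise lift is injective because [a] is; its labels are those of [a] divided by those of
    [b]. *)
Lemma hcomp_factor n m l (a : hom n l) (b : hom m l) :
  (forall x, exists y, hf b y = hf a x) -> exists c, a = hcomp b c.
Proof.
move=> /choice [f fE].
have fi : injective f.
  by move=> x y e; apply: (@hf_inj _ _ _ a); rewrite -!fE e.
exists (HomG fi (fun x => hg a x * (hg b (f x))^-1)%g).
by apply: homG_eq => x /=; rewrite ?fE // -mulgA mulVg mulg1.
Qed.

Lemma hsurj n m (a : hom n m) : (m <= n)%N -> forall y, exists x, hf a x = y.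
Proof.
move=> le y; have : y \in [set: 'I_m] by rewrite inE.
have /eqP <- : hf a @: [set: 'I_n] == setT.
  rewrite eqEcard subsetT (card_imset _ (@hf_inj _ _ _ a)) !cardsT !card_ord.
  exact: le.
by case/imsetP => x _ ->; exists x.
Qed.

(** With [homG_leq] the two degrees agree. Keeping them as separate variables allows use with [r]
    and [#|himg h|]. *)
Lemma hinv n m (a : hom n m) : (m <= n)%N ->
  exists2 b : hom m n, hcomp a b = hid G m & hcomp b a = hid G n.
Proof.
move=> le; have [|b e] := @hcomp_factor _ _ _ (hid G m) a.
  by move=> x; apply: hsurj.
exists b => //; apply: (@hcompI _ _ _ a).
by rewrite hcompA -e hcomp1h hcomph1.
Qed.

(** A chosen morphism with image [A]; the others differ from it by an isomorphism of the source. *)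
Definition hset n (A : {set 'I_n}) : hom #|A| n :=
  HomG (@enum_val_inj _ (mem A)) (fun=> 1%g).

Lemma hset_in n (A : {set 'I_n}) x : hf (hset A) x \in A.
Proof. exact: enum_valP. Qed.

Lemma hset_onto n (A : {set 'I_n}) y : y \in A -> exists x, hf (hset A) x = y.
Proof. by move=> yA; exists (enum_rank_in yA y); apply: enum_rankK_in. Qed.

Definition himg n m (a : hom n m) : {set 'I_m} := [set hf a x | x : 'I_n].

Lemma card_himg n m (a : hom n m) : #|himg a| = n.
Proof. by rewrite /himg card_imset ?card_ord //; apply: hf_inj. Qed.

Lemma himg_in n m (a : hom n m) x : hf a x \in himg a.
Proof. exact: imset_f. Qed.

Lemma himg_hset n (A : {set 'I_n}) : himg (hset A) = A.
Proof.
apply/setP => y; apply/imsetP/idP => [[x _ ->]|/hset_onto [x <-]].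
  exact: hset_in.
by exists x.
Qed.

Lemma himg_hcomp n m l (a : hom m l) (b : hom n m) :
  himg (hcomp a b) = hf a @: himg b.
Proof. by rewrite /himg -imset_comp. Qed.

Lemma hset_factor n m (a : hom n m) (A : {set 'I_m}) :
  himg a \subset A -> exists c, a = hcomp (hset A) c.
Proof.
move=> /subsetP sA; apply: hcomp_factor => x.
by apply: hset_onto; apply: sA; apply: himg_in.
Qed.

(** * Block sums and shifts of morphisms *)

Definition hinc b n : hom n (b + n) := HomG (@rshift_inj b n) (fun=> 1%g).

Definition hsum_fun b n m (a : 'I_b -> 'I_m) (c : 'I_n -> 'I_m) (x : 'I_(b + n)) :=
  match split x with inl i => a i | inr j => c j end.

Lemma hsum_fun_l b n m (a : 'I_b -> 'I_m) (c : 'I_n -> 'I_m) i :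
  hsum_fun a c (lshift n i) = a i.
Proof. by rewrite /hsum_fun (unsplitK (inl i)). Qed.

Lemma hsum_fun_r b n m (a : 'I_b -> 'I_m) (c : 'I_n -> 'I_m) j :
  hsum_fun a c (rshift b j) = c j.
Proof. by rewrite /hsum_fun (unsplitK (inr j)). Qed.

Lemma hsum_fun_inj b n m (a : 'I_b -> 'I_m) (c : 'I_n -> 'I_m) :
  injective a -> injective c -> (forall i j, a i <> c j) ->
  injective (hsum_fun a c).
Proof.
move=> ai ci ac x y; rewrite /hsum_fun.
case: (split_ordP x) => i ->; case: (split_ordP y) => j -> //=.
- by move/ai->.
- by move/ac.
- by move/esym/ac.
- by move/ci->.
Qed.

Definition hsum b n m (a : hom b m) (c : hom n m)
    (ac : forall i j, hf a i <> hf c j) : hom (b + n) m :=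
  HomG (hsum_fun_inj (@hf_inj _ _ _ a) (@hf_inj _ _ _ c) ac)
    (fun x => match split x with inl i => hg a i | inr j => hg c j end).

Lemma hsum_hinc b n m (a : hom b m) (c : hom n m) ac :
  hcomp (@hsum b n m a c ac) (hinc b n) = c.
Proof.
apply: homG_eq => x /=; rewrite /hsum_fun (unsplitK (inr x)) //.
by rewrite mul1g.
Qed.

Definition hlinc b n : hom b (b + n) := HomG (@lshift_inj b n) (fun=> 1%g).

Lemma lshift_neq_rshift b n (i : 'I_b) (j : 'I_n) : lshift n i <> rshift b j.
Proof. by move/eqP; rewrite eq_lrshift. Qed.

Definition hshift b n m (a : hom n m) : hom (b + n) (b + m) :=
  @hsum _ _ _ (hlinc b m) (hcomp (hinc b m) a)
    (fun i j => @lshift_neq_rshift b m i (hf a j)).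

Lemma hshift_id b n : hshift b (hid G n) = hid G (b + n).
Proof.
by apply: homG_eq => x /=; rewrite /hsum_fun; case: (split_ordP x) => i e;
   rewrite ?e // mul1g.
Qed.

Lemma hshift_l b n m (a : hom n m) i : hf (hshift b a) (lshift n i) = lshift m i.
Proof. exact: hsum_fun_l. Qed.

Lemma hshift_r b n m (a : hom n m) i :
  hf (hshift b a) (rshift b i) = rshift b (hf a i).
Proof. exact: hsum_fun_r. Qed.

Lemma hshift_comp b n m l (a : hom m l) (c : hom n m) :
  hshift b (hcomp a c) = hcomp (hshift b a) (hshift b c).
Proof.
apply: homG_eq => x /=; rewrite /hsum_fun; case: (split_ordP x) => i e /=.
- by rewrite (unsplitK (inl i)).
- by rewrite (unsplitK (inr _)).
- by rewrite (unsplitK (inl i)) mul1g.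
- by rewrite (unsplitK (inr _)) !mulg1.
Qed.

Lemma hshift_hinc b n m (a : hom n m) :
  hcomp (hshift b a) (hinc b n) = hcomp (hinc b m) a.
Proof. exact: hsum_hinc. Qed.

Lemma hincS b n : hinc b.+1 n = hcomp (hinc 1 (b + n)) (hinc b n).
Proof. by apply: homG_eq => x /=; [apply: val_inj | rewrite mulg1]. Qed.

(** The first block is fixed by shifted morphisms, so only the points of [a] in the second block
    count for generation in the shift. *)
Lemma hshift_factor b n j (a : hom j (b + n)) :
  let S := [set i | rshift b i \in himg a] in
  exists c, a = hcomp (hshift b (hset S)) c.
Proof.
move=> S; apply: hcomp_factor => x.
case: (split_ordP (hf a x)) => i e.
  by exists (lshift _ i); rewrite hshift_l.
have /hset_onto [y ey] : i \in S by rewrite inE -e himg_in.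
by exists (rshift b y); rewrite hshift_r ey.
Qed.

Lemma card_second_block b n j (a : hom j (b + n)) :
  (#|[set i | rshift b i \in himg a]| <= j)%N.
Proof.
rewrite -[X in (_ <= X)%N](card_himg a) -(card_imset _ (@rshift_inj b n)).
by apply/subset_leq_card/subsetP => y /imsetP [i]; rewrite inE => ? ->.
Qed.

(** This strict drop drives the induction on the generation degree. *)
Lemma card_second_block_lt b n j (a : hom j (b + n)) i :
  lshift n i \in himg a -> (#|[set i | rshift b i \in himg a]| < j)%N.
Proof.
move=> ia; rewrite -[X in (_ < X)%N](card_himg a) -(card_imset _ (@rshift_inj b n)).
apply/proper_card/properP; split.
  by apply/subsetP => y /imsetP [l]; rewrite inE => ? ->.
by exists (lshift n i) => //; apply/imsetP => -[l _] /lshift_neq_rshift.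
Qed.

(** Image points are sent back with inverse labels and all others go to the first block. Thus
    saturation need only be tested on [hinc]. *)
Lemma hinc_factor n m (a : hom n m) : exists c, hcomp c a = hinc m n.
Proof.
pose f (y : 'I_m) := if [pick x | hf a x == y] is Some x then rshift m x
                     else lshift n y.
have fa x : f (hf a x) = rshift m x.
  rewrite /f; case: pickP => [z /eqP /hf_inj -> //|/(_ x)].
  by rewrite eqxx.
have fi : injective f.
  move=> y y'; rewrite /f.
  case: pickP => [x /eqP <-|_]; case: pickP => [x' /eqP <-|_].
  - by move/rshift_inj->.
  - by move/esym/lshift_neq_rshift.
  - by move/lshift_neq_rshift.
  - by move/lshift_inj.
exists (HomG fi (fun y => if [pick x | hf a x == y] is Some x
                          then (hg a x)^-1 else 1)%g).
apply: homG_eq => x /=; first exact: fa.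
case: pickP => [z /eqP /hf_inj ->|/(_ x)]; last by rewrite eqxx.
by rewrite mulgV.
Qed.

Lemma hout n m (a : hom n m) : (n < m)%N -> exists b, forall x, b <> hf a x.
Proof.
move=> lt; have : (0 < #|~: himg a|)%N.
  by rewrite cardsCs setCK card_ord card_himg subn_gt0.
case/card_gt0P => b; rewrite inE => /negP nb; exists b => x e.
by apply: nb; rewrite e himg_in.
Qed.

End Homs.

(** * Submodules, generation and shifts *)

Section Linear.
Variables (G : groupType) (k : comPzRingType).

HB.instance Definition _ (X : fimod G k) n m (a : homG G n m) :=
  GRing.isLinear.Build k (Vsp X n) (Vsp X m) *:%R (act a) (act_lin a).

Lemma act_sum (X : fimod G k) n m (a : homG G n m) I (r : seq I) P
    (F : I -> Vsp X n) :
  act a (\sum_(i <- r | P i) F i) = \sum_(i <- r | P i) act a (F i).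
Proof. exact: raddf_sum. Qed.

Lemma act_sign (X : fimod G k) n m (a : homG G n m) q (x : Vsp X n) :
  act a ((-1) ^+ q *: x) = (-1) ^+ q *: act a x.
Proof. exact: linearZ. Qed.

Lemma klinear0 (U W : lmodType k) (f : U -> W) : klinear f -> f 0 = 0.
Proof.
move=> /(_ 1 0 0); rewrite !scale1r addr0 => /eqP.
by rewrite -subr_eq subrr eq_sym => /eqP.
Qed.

Lemma klinear_sum (U W : lmodType k) (f : U -> W) I (r : seq I) P (F : I -> U) :
  klinear f -> f (\sum_(i <- r | P i) F i) = \sum_(i <- r | P i) f (F i).
Proof.
move=> fl; elim/big_rec2: _ => [|i y x _ <-]; first exact: klinear0.
by rewrite -[F i in LHS]scale1r fl scale1r.
Qed.

End Linear.

(** * Submodules as FI_G-modules *)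

Section Submodule.
Variables (G : groupType) (k : comPzRingType).
Variables (X : fimod G k) (Y : forall n, Vsp X n -> Prop).
Hypothesis sY : is_submodule Y.

Lemma sub0 n : Y (0 : Vsp X n). Proof. exact: sY.1. Qed.
Lemma subP n c (x y : Vsp X n) : Y x -> Y y -> Y (c *: x + y).
Proof. exact: sY.2.1. Qed.
Lemma subact n m (a : homG G n m) (x : Vsp X n) : Y x -> Y (act a x).
Proof. exact: sY.2.2. Qed.
Lemma subZ n c (x : Vsp X n) : Y x -> Y (c *: x).
Proof. by move=> Yx; rewrite -[_ *: _]addr0; apply: subP => //; apply: sub0. Qed.
Lemma subD n (x y : Vsp X n) : Y x -> Y y -> Y (x + y).
Proof. by move=> Yx; rewrite -[x]scale1r; apply: subP. Qed.
Lemma subN n (x : Vsp X n) : Y x -> Y (- x).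
Proof. by rewrite -scaleN1r; apply: subZ. Qed.
Lemma subsum n I (r : seq I) (P : pred I) (F : I -> Vsp X n) :
  (forall i, P i -> Y (F i)) -> Y (\sum_(i <- r | P i) F i).
Proof. by move=> YF; elim/big_rec: _ => [|i x Pi]; [apply: sub0 | apply/subD/YF]. Qed.

Record subsp (n : nat) := Subsp { subval : Vsp X n; subvalP : Y subval }.

Lemma subval_inj n : injective (@subval n).
Proof.
case=> x Yx [y Yy] /= e; move: Yx Yy; rewrite e => Yx Yy.
by rewrite (Prop_irrelevance Yx Yy).
Qed.

HB.instance Definition _ n := gen_eqMixin (subsp n).
HB.instance Definition _ n := gen_choiceMixin (subsp n).

Definition subsp0 n := Subsp (@sub0 n).
Definition subsp_add n (x y : subsp n) := Subsp (subD (subvalP x) (subvalP y)).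
Definition subsp_opp n (x : subsp n) := Subsp (subN (subvalP x)).
Definition subsp_scale n c (x : subsp n) := Subsp (subZ c (subvalP x)).

Fact subsp_addA n : associative (@subsp_add n).
Proof. by move=> x y z; apply: subval_inj; apply: addrA. Qed.
Fact subsp_addC n : commutative (@subsp_add n).
Proof. by move=> x y; apply: subval_inj; apply: addrC. Qed.
Fact subsp_add0 n : left_id (@subsp0 n) (@subsp_add n).
Proof. by move=> x; apply: subval_inj; apply: add0r. Qed.
Fact subsp_addN n : left_inverse (@subsp0 n) (@subsp_opp n) (@subsp_add n).
Proof. by move=> x; apply: subval_inj; apply: addNr. Qed.

HB.instance Definition _ n :=
  GRing.isZmodule.Build (subsp n) (@subsp_addA n) (@subsp_addC n)
    (@subsp_add0 n) (@subsp_addN n).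

Fact subsp_scaleA n c d (x : subsp n) :
  subsp_scale c (subsp_scale d x) = subsp_scale (c * d) x.
Proof. by apply: subval_inj; apply: scalerA. Qed.
Fact subsp_scale1 n : left_id 1 (@subsp_scale n).
Proof. by move=> x; apply: subval_inj; apply: scale1r. Qed.
Fact subsp_scaleDr n : right_distributive (@subsp_scale n) +%R.
Proof. by move=> c x y; apply: subval_inj; apply: scalerDr. Qed.
Fact subsp_scaleDl n (x : subsp n) : {morph (@subsp_scale n)^~ x : c d / c + d}.
Proof. by move=> c d; apply: subval_inj; apply: scalerDl. Qed.

HB.instance Definition _ n :=
  GRing.Zmodule_isLmodule.Build k (subsp n) (@subsp_scaleA n) (@subsp_scale1 n)
    (@subsp_scaleDr n) (@subsp_scaleDl n).

Definition subsp_act n m (a : homG G n m) (x : subsp n) :=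
  Subsp (subact a (subvalP x)).

Definition submod : fimod G k.
Proof.
refine (@FIMod G k (fun n => subsp n : lmodType k) subsp_act _ _ _ _).
- by move=> n m a c x y; apply: subval_inj; apply: act_lin.
- by move=> n m a b ab x; apply: subval_inj; apply: act_ext.
- by move=> n x; apply: subval_inj; apply: act_id.
- by move=> n m l a b x; apply: subval_inj; apply: act_comp.
Defined.

End Submodule.


Section Generation.
Variables (G : groupType) (k : comPzRingType).
Implicit Type X : fimod G k.

(** The submodule generated by [P], as the intersection of all submodules containing it. *)
Definition spanned X (P : forall n, Vsp X n -> Prop) n (x : Vsp X n) : Prop :=
  forall W, is_submodule W -> (forall m (y : Vsp X m), P m y -> W m y) -> W n x.

Lemma spanned_sub X (P : forall n, Vsp X n -> Prop) : is_submodule (spanned P).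
Proof.
split; [|split].
- by move=> n W sW _; apply: sub0.
- by move=> n c x y Hx Hy W sW PW; apply: subP => //; [apply: Hx | apply: Hy].
- by move=> n m a x Hx W sW PW; apply: subact => //; apply: Hx.
Qed.

Lemma spanned_in X (P : forall n, Vsp X n -> Prop) n (x : Vsp X n) :
  P n x -> spanned P x.
Proof. by move=> Px W _; apply. Qed.

(* The strict bound lets the induction on [d] start from [X = 0]. *)
Definition gen_lt X d := forall n (x : Vsp X n), spanned (fun m _ => (m < d)%N) x.

Lemma gen_fin_deg_lt X : gen_fin_deg X -> exists d, gen_lt X d.
Proof. by case=> N gN; exists N.+1 => n x W sW HW; apply: gN. Qed.

(** Phrased inside [X]; [gen_sub_submod] turns it into generation of the module [submod]. *)
Definition gen_sub X (Y : forall n, Vsp X n -> Prop) R :=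
  forall n (x : Vsp X n), Y n x -> spanned (fun m y => (m <= R)%N /\ Y m y) x.

(** The elements of [X] that come from [W] form a submodule containing [P], hence the span of
    [P]. *)
Lemma submod_induction X (Y P : forall n, Vsp X n -> Prop) (sY : is_submodule Y)
    (W : forall n, Vsp (submod sY) n -> Prop) :
  is_submodule W ->
  (forall n (x : Vsp (submod sY) n), P n (subval x) -> W n x) ->
  (forall n (x : Vsp X n), P n x -> Y n x) ->
  forall n (x : Vsp (submod sY) n), spanned P (subval x) -> W n x.
Proof.
move=> sW PW PY n x Hx.
suff [z /subval_inj <- //] : exists2 z : Vsp (submod sY) n,
    subval z = subval x & W n z.
apply: (Hx (fun m y => exists2 z : Vsp (submod sY) m, subval z = y & W m z)).
- split; [|split].
  + by move=> m; exists 0 => //; apply: sub0.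
  + move=> m c _ _ [u <- Wu] [v <- Wv]; exists (c *: u + v) => //.
    exact: subP.
  + by move=> m l a _ [u <- Wu]; exists (act a u) => //; apply: subact.
- by move=> m y Py; exists (Subsp (PY _ _ Py)) => //; apply: PW.
Qed.

Lemma gen_sub_submod X (Y : forall n, Vsp X n -> Prop) (sY : is_submodule Y) R :
  gen_sub Y R -> gen_fin_deg (submod sY).
Proof.
move=> gY; exists R => W sW HW n x.
apply: (submod_induction sW _ _ (gY _ _ (subvalP x))) => [m y [le _]|m y []//].
exact: HW.
Qed.

Lemma gen_lt_span X d
    (sP := @spanned_sub X (fun m _ => (m < d)%N)) :
  gen_lt (submod sP) d.
Proof.
move=> n x W sW HW.
apply: (submod_induction sW _ _ (subvalP x)) => [m y lt|m y lt].
  exact: HW.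
exact: spanned_in.
Qed.

Definition fishift (b : nat) X : fimod G k.
Proof.
refine (@FIMod G k (fun n => Vsp X (b + n)) (fun n m a => act (hshift b a)) _ _ _ _).
- by move=> n m a; apply: act_lin.
- by move=> n m a c [af ag] x; rewrite (homG_eq af ag).
- by move=> n x; rewrite hshift_id act_id.
- by move=> n m l a c x; rewrite hshift_comp act_comp.
Defined.

(** The elements all of whose images in degree [n] lie in [W] form a submodule, so a linear
    condition in one degree can be checked on images of generators. *)
Lemma gen_lt_act X d n (W : Vsp X n -> Prop) :
  gen_lt X d -> W 0 ->
  (forall c (x y : Vsp X n), W x -> W y -> W (c *: x + y)) ->
  (forall j (a : homG G j n) (z : Vsp X j), (j < d)%N -> W (act a z)) ->
  forall x : Vsp X n, W x.
Proof.
move=> gX W0 WD Wact x.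
suff : forall a : homG G n n, W (act a x) by move=> /(_ (hid G n)); rewrite act_id.
apply: (gX n x (fun m y => forall a : homG G m n, W (act a y))) => [|m y lt a].
  split; [|split].
  - by move=> m a; rewrite raddf0.
  - by move=> m c u v Wu Wv a; rewrite linearP; apply: WD; [apply: Wu|apply: Wv].
  - by move=> m l a u Wu b; rewrite -act_comp; apply: Wu.
exact: Wact.
Qed.

Lemma fishift_spanned X b d j n (a : homG G j (b + n)) (z : Vsp X j) :
  (#|[set i | rshift b i \in himg a]| < d)%N ->
  @spanned (fishift b X) (fun m _ => (m < d)%N) n (act a z).
Proof.
move=> lt; have [c ->] := hshift_factor a.
rewrite act_comp.
apply: (@subact _ _ (fishift b X) _ (@spanned_sub _ _) _ _ (hset G _)).
exact: spanned_in.
Qed.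

Lemma gen_lt_fishift X b d : gen_lt X d -> gen_lt (fishift b X) d.
Proof.
move=> gX n; pose S := @spanned_sub (fishift b X) (fun m _ => (m < d)%N).
apply: (gen_lt_act (X := X) (n := b + n)) => //; first exact: (sub0 S).
- exact: (subP S).
- move=> j a z lt; apply: fishift_spanned.
  exact: leq_ltn_trans (card_second_block a) lt.
Qed.

End Generation.

(** * Saturated submodules are generated in finite degree *)

Section Core.
Variables (G : groupType) (k : comPzRingType).
Implicit Type X : fimod G k.

(** Terms [act a z] are grouped by the image of [a]. *)
Lemma gen_lt_decomp X d n (x : Vsp X n) : gen_lt X d.+1 ->
  exists zeta : forall A : {set 'I_n}, Vsp X #|A|,
    x = \sum_(A : {set 'I_n} | (#|A| <= d)%N) act (hset G A) (zeta A).
Proof.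
move=> gX; move: x; apply: (gen_lt_act gX) => [|c _ _ [u ->] [v ->]|j a z lt].
- by exists (fun=> 0); rewrite big1 // => A _; rewrite raddf0.
- exists (fun A => c *: u A + v A); rewrite scaler_sumr -big_split /=.
  by apply: eq_bigr => A _; rewrite linearP.
- have [c ac] := hset_factor (subxx (himg a)).
  exists (@dfwith _ (fun A : {set 'I_n} => Vsp X #|A|) (fun=> 0) (himg a) (act c z)).
  rewrite (bigD1 (himg a)) ?card_himg //= dfwith_in -act_comp -ac big1 ?addr0 //.
  by move=> A /andP [_ nA]; rewrite dfwith_out 1?eq_sym // raddf0.
Qed.

(** * Alternating sums of moves to fresh points *)

Lemma sum_toggle (T : finType) (i : T) (M : zmodType) (F : {set T} -> M) :
  (forall Q : {set T}, i \notin Q -> F (i |: Q) = - F Q) -> \sum_Q F Q = 0.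
Proof.
move=> FN; rewrite (bigID (fun Q : {set T} => i \in Q)) /=.
rewrite (reindex_onto (fun Q : {set T} => i |: Q) (fun Q => Q :\ i)) /=; last first.
  by move=> Q iQ; rewrite setD1K.
rewrite (eq_bigl (fun Q : {set T} => i \notin Q)); last first.
  move=> Q; rewrite setU11 /=; apply/eqP/idP => [<-|iQ]; first by rewrite !inE eqxx.
  by apply/setP => y; rewrite !inE; case: eqVneq => // ->; rewrite (negPf iQ).
by rewrite (eq_bigr _ FN) sumrN addNr.
Qed.

(* [hmove A Q] is the inclusion of [m] into the second block of [#|A| + m],
   except that the points of [A] indexed by [Q] move to the first block. *)
Definition hmove_fun m (A : {set 'I_m}) (Q : {set 'I_#|A|}) (y : 'I_m) :
    'I_(#|A| + m) :=
  if [pick i in Q | hf (hset G A) i == y] is Some i then lshift m i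
  else rshift _ y.

Lemma hmove_fun_inj m (A : {set 'I_m}) (Q : {set 'I_#|A|}) :
  injective (hmove_fun Q).
Proof.
move=> y y'; rewrite /hmove_fun.
case: pickP => [x /andP [_ /eqP <-]|_]; case: pickP => [x' /andP [_ /eqP <-]|_].
- by move/lshift_inj->.
- by move/lshift_neq_rshift.
- by move/esym/lshift_neq_rshift.
- by move/rshift_inj.
Qed.

Definition hmove m (A : {set 'I_m}) (Q : {set 'I_#|A|}) : homG G m (#|A| + m) :=
  HomG (@hmove_fun_inj m A Q) (fun=> 1%g).

(** The effect of [hmove] on the points of [A] alone, with [A] identified with ['I_e]. *)
Definition hdouble_fun e (Q : {set 'I_e}) (i : 'I_e) : 'I_(e + e) :=
  if i \in Q then lshift e i else rshift e i.

Lemma hdouble_fun_inj e (Q : {set 'I_e}) : injective (hdouble_fun Q).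
Proof.
move=> i j; rewrite /hdouble_fun; case: ifP => _; case: ifP => _.
- exact: lshift_inj.
- by move/lshift_neq_rshift.
- by move/esym/lshift_neq_rshift.
- exact: rshift_inj.
Qed.

Definition hdouble e (Q : {set 'I_e}) : homG G e (e + e) :=
  HomG (@hdouble_fun_inj e Q) (fun=> 1%g).

Lemma hmove_hset m (A : {set 'I_m}) (Q : {set 'I_#|A|}) :
  hcomp (hmove Q) (hset G A) = hcomp (hshift #|A| (hset G A)) (hdouble Q).
Proof.
apply: homG_eq => i.
  rewrite /= /hmove_fun /hdouble_fun.
  case: pickP => [j /andP [jQ /eqP /(@hf_inj _ _ _ (hset G A)) <-]|/(_ i)] /=.
    by rewrite jQ hsum_fun_l.
  by rewrite eqxx andbT => ->; rewrite hsum_fun_r.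
rewrite /= !mul1g; case: split => // j; by rewrite mul1g.
Qed.

Lemma hmove_toggle m (A : {set 'I_m}) (Q : {set 'I_#|A|}) i j (a : homG G j m) :
  hf (hset G A) i \notin himg a ->
  hcomp (hmove (i |: Q)) a = hcomp (hmove Q) a.
Proof.
move=> ia; apply: homG_eq => //= x; rewrite /hmove_fun /=.
rewrite (@eq_pick _ _ (fun l => (l \in Q) && (hf (hset G A) l == hf a x))) //.
move=> l; rewrite /= !inE; case: (eqVneq l i) => //= ->.
suff /negPf -> : hf (hset G A) i != hf a x by rewrite andbF.
by apply: contraNneq ia => ->; apply: himg_in.
Qed.

Definition altmove X m (A : {set 'I_m}) (x : Vsp X m) : Vsp X (#|A| + m) :=
  \sum_(Q : {set 'I_#|A|}) (-1) ^+ #|Q| *: act (@hmove m A Q) x.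

(** Moving a point of [A] outside the image of [a] changes the sign of a term but not its value, so
    terms cancel in pairs. *)
Lemma altmove0 X m (A : {set 'I_m}) j (a : homG G j m) (z : Vsp X j) :
  ~~ (A \subset himg a) -> altmove A (act a z) = 0.
Proof.
case/subsetPn => y /(hset_onto G) [i <-] ia; apply: (@sum_toggle _ i) => Q iQ.
by rewrite -!act_comp hmove_toggle // cardsU1 iQ exprS mulN1r scaleNr.
Qed.

Lemma altmove_sum X m (A : {set 'I_m}) I (r : seq I) P (F : I -> Vsp X m) :
  altmove A (\sum_(i <- r | P i) F i) = \sum_(i <- r | P i) altmove A (F i).
Proof.
rewrite /altmove exchange_big /=; apply: eq_bigr => Q _.
by rewrite act_sum scaler_sumr.
Qed.

Definition altdouble X e (z : Vsp X e) : Vsp X (e + e) :=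
  \sum_(Q : {set 'I_e}) (-1) ^+ #|Q| *: act (hdouble Q) z.

Lemma altmove_hset X m (A : {set 'I_m}) (z : Vsp X #|A|) :
  altmove A (act (hset G A) z) = act (hshift #|A| (hset G A)) (altdouble z).
Proof.
rewrite /altmove /altdouble act_sum; apply: eq_bigr => Q _.
by rewrite act_sign -!act_comp hmove_hset.
Qed.

(** Among sets of size at most [d = #|A|] only [A] contains [A], so [altmove A] keeps a single term;
    saturation then pulls it back from degree [d + m] to [d + d]. *)
Lemma altdouble_isolate X (Y : forall n, Vsp X n -> Prop) d m
    (zeta : forall A : {set 'I_m}, Vsp X #|A|) (A : {set 'I_m}) :
  is_submodule Y ->
  (forall n m (a : homG G n m) (x : Vsp X n), Y m (act a x) -> Y n x) ->
  Y m (\sum_(B : {set 'I_m} | (#|B| <= d)%N) act (hset G B) (zeta B)) ->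
  #|A| = d -> Y _ (altdouble (zeta A)).
Proof.
move=> sY satY Yx cA; apply: (satY _ _ (hshift #|A| (hset G A))).
rewrite -altmove_hset.
suff <- : altmove A (\sum_(B : {set 'I_m} | (#|B| <= d)%N) act (hset G B) (zeta B))
    = altmove A (act (hset G A) (zeta A)).
  by apply: (subsum sY) => Q _; apply: (subZ sY); apply: (subact sY).
rewrite altmove_sum (bigD1 A) ?cA //= big1 ?addr0 // => B /andP [cB nB].
apply: altmove0; rewrite himg_hset; apply: contraNN nB => AB.
by rewrite eq_sym eqEcard AB cA.
Qed.

Lemma hset_meets_block X d n (A : {set 'I_(d + n)}) i (z : Vsp X #|A|) :
  (#|A| <= d)%N -> lshift n i \in A ->
  @spanned G k (fishift d X) (fun j _ => (j < d)%N) n (act (hset G A) z).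
Proof.
move=> cA iA; apply: fishift_spanned; apply: leq_trans cA.
by apply: (@card_second_block_lt _ _ _ _ _ i); rewrite himg_hset.
Qed.

(* Sending the first copy of [A] into the first block of [d + n] rewrites
   [act (hset A) z], modulo the image of [altdouble z], in terms of elements
   meeting that block. *)
Lemma hset_reduce X d n (A : {set 'I_(d + n)}) (z : Vsp X #|A|) :
  #|A| = d -> (forall i, lshift n i \notin A) ->
  exists v : homG G (#|A| + #|A|) (d + n),
  @spanned G k (fishift d X) (fun j _ => (j < d)%N) n
    (act (hset G A) z - act v (altdouble z)).
Proof.
move=> cA nA; pose S := @spanned_sub G k (fishift d X) (fun j _ => (j < d)%N).
(* [b] carries the first copy of [A] onto the first block, which [A] itself avoids. *)
pose b : homG G #|A| (d + n) :=
  HomG (inj_comp (@lshift_inj d n) (@cast_ord_inj _ _ cA)) (fun=> 1%g).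
have bA i j : hf b i <> hf (hset G A) j.
  by move=> e; have := nA (cast_ord cA i); rewrite [lshift _ _]e hset_in.
(* The term [Q = set0] moves nothing and returns [act (hset G A) z]. *)
exists (hsum bA); rewrite /altdouble act_sum (bigD1 set0) //= cards0 expr0 scale1r.
rewrite -act_comp; set w := hcomp _ _.
have -> : w = hset G A.
  by apply: homG_eq => x /=; rewrite /hdouble_fun inE ?hsum_fun_r //
    (unsplitK (inr x)) mulg1.
rewrite opprD addrA subrr add0r; apply: (subN S).
(* Any other [Q] puts a point into the first block, leaving fewer than [d] in the second. *)
apply: (subsum S) => Q /set0Pn [i iQ]; rewrite act_sign; apply: (subZ S).
rewrite -act_comp; apply: fishift_spanned; rewrite -[X in (_ < X)%N]cA.
apply: (@card_second_block_lt _ _ _ _ _ (cast_ord cA i)).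
apply/imsetP; exists i => //=; rewrite /hdouble_fun iQ.
by rewrite hsum_fun_l.
Qed.

(** Saturation of [Y] says that [X / Y] is torsion-free. *)
Lemma gen_sub_saturated d X (Y : forall n, Vsp X n -> Prop) :
  gen_lt X d -> is_submodule Y ->
  (forall n m (a : homG G n m) (x : Vsp X n), Y m (act a x) -> Y n x) ->
  exists R, gen_sub Y R.
Proof.
elim: d X Y => [|d IH] X Y gX sY satY.
  (* Generation below degree 0 forces [X = 0]. *)
  exists 0%N => n x _ W sW _.
  by apply: gX.
pose S := @spanned_sub G k (fishift d X) (fun j _ => (j < d)%N).
pose Y1 n (x : Vsp (submod S) n) := Y (d + n)%N (subval x).
have [||R1 gY1] := IH (submod S) Y1 (@gen_lt_span _ _ _ _).
- split; [|split].
  + by move=> n; apply: (sub0 sY).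
  + by move=> n c x y; apply: (subP sY).
  + by move=> n m a x; apply: (subact sY).
- by move=> n m a x; apply: satY.
(* [altdouble] of a piece of size [d] lives in degree [d + d]; degree [R1] of the shift is degree
   [d + R1] of [X]. *)
exists (maxn (d + d) (d + R1)) => m y Yy W sW YW.
have [le|/ltnW] := leqP m d.
  by apply: YW; split=> //; rewrite leq_max (leq_trans le) ?leq_addr.
move=> /subnKC e; move: y Yy; rewrite -{}e; move: (m - d)%N => {m} n y Yy.
have [zeta yE] := gen_lt_decomp y gX.
(* Pieces of size at most [d] outside [T] already lie in the span [S]; those in [T] need a
   correction. *)
pose T (A : {set 'I_(d + n)}) := (#|A| == d) && [forall i, lshift n i \notin A].
have /choice [v vP] : forall A : {set 'I_(d + n)}, exists v : Vsp X (d + n),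
    [/\ Y _ v, W _ v & (#|A| <= d)%N -> 
    @spanned G k (fishift d X) (fun j _ => (j < d)%N) n (act (hset G A) (zeta A) - v)].
  move=> A; have [/andP [/eqP cA /forallP nA]|nT] := boolP (T A); last first.
    exists 0; split; [exact: sub0 | exact: sub0|] => cA; rewrite subr0.
    move: nT; rewrite negb_and => /orP [ncA|].
      apply: fishift_spanned; apply: leq_ltn_trans (card_second_block _) _.
      by rewrite ltn_neqAle ncA.
    rewrite negb_forall => /existsP [i]; rewrite negbK => iA.
    exact: hset_meets_block cA iA.
  have [v vP] := hset_reduce (zeta A) cA nA.
  have Yd : Y _ (altdouble (zeta A)).
    by apply: (@altdouble_isolate X Y d _ zeta A sY satY) cA; rewrite -yE.
  exists (act v (altdouble (zeta A))); split => //; first exact: subact.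
  by apply: subact => //; apply: YW; split=> //; rewrite cA leq_maxl.
(* The corrections lie in [Y] and [W], so [y - v0] lies in [Y] and [S], where the induction
   hypothesis applies. *)
pose v0 := \sum_(A : {set 'I_(d + n)} | (#|A| <= d)%N) v A.
have Yv : Y _ v0 by apply: subsum => // A _; have [] := vP A.
have Wv : W _ v0 by apply: subsum => // A _; have [] := vP A.
have sv : @spanned G k (fishift d X) (fun j _ => (j < d)%N) n (y - v0).
  by rewrite yE /v0 -sumrB; apply: (subsum S) => A cA; have [_ _ ] := vP A; apply.
rewrite -(subrK v0 y); apply: subD => //.
have /= := gY1 n (Subsp sv) (subD sY Yy (subN sY Yv))
  (fun j (x : Vsp (submod S) j) => W (d + j)%N (subval x)).
apply.
  split; [|split].
  + by move=> j; apply: (sub0 sW).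
  + by move=> j c x z; apply: (subP sW).
  + by move=> j l a x; apply: (subact sW).
move=> j x [le Yx]; apply: YW; split=> //.
by rewrite leq_max (leq_add2l d j R1) le orbT.
Qed.

(* Shifting by [t + 1] turns saturation in degrees above [t] into saturation. *)
Lemma gen_sub_saturated_above t X (Y : forall n, Vsp X n -> Prop) :
  gen_fin_deg X -> is_submodule Y ->
  (forall n m (a : homG G n m) (x : Vsp X n), (t < n)%N -> Y m (act a x) -> Y n x) ->
  exists R, gen_sub Y R.
Proof.
move=> /gen_fin_deg_lt [d gX] sY satY.
pose Y1 n (x : Vsp (fishift t.+1 X) n) := Y (t.+1 + n)%N x.
have [||R gY1] := gen_sub_saturated (Y := Y1) (@gen_lt_fishift _ _ X t.+1 d gX).
- split; [|split].
  + by move=> n; apply: (sub0 sY).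
  + by move=> n c x y; apply: (subP sY).
  + by move=> n m a x; apply: (subact sY).
- by move=> n m a x; apply: satY; rewrite ltn_addr.
(* Degrees up to [t] are covered by [YW] directly; all others are degrees of the shift. *)
exists (t.+1 + R)%N => m y Yy W sW YW.
have [le|/subnKC e] := leqP m t.
  by apply: YW; split=> //; rewrite (leq_trans (leqW le)) ?leq_addr.
move: y Yy; rewrite -{}e; move: (m - t.+1)%N => n y Yy.
apply: (gY1 n y Yy (fun j x => W (t.+1 + j)%N x)).
  split; [|split].
  + by move=> j; apply: (sub0 sW).
  + by move=> j c x z; apply: (subP sW).
  + by move=> j l a x; apply: (subact sW).
by move=> j x [le Yx]; apply: YW; split=> //; rewrite leq_add2l.
Qed.

End Core.

(** * A concrete model of free modules *)

Section FreeModel.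
Variables (G : groupType) (k : comPzRingType) (V : fimod G k) (N : nat).
Local Notation hom := (homG G).

(* The free module on [V_0, ..., V_N]: since [G_r] acts freely on
   [Hom([r], [n])] with finitely many orbits, the summand
   [k[Hom([r], [n])] (x)_{kG_r} V_r] consists of the [G_r]-equivariant
   functions [Hom([r], [n]) -> V_r]. *)
Record efun (n : nat) := Efun {
  efn : forall r, hom r n -> Vsp V r;
  efn_eqv : forall r (h : hom r n) (s : hom r r),
    efn h = act s (efn (hcomp h s));
  efn_supp : forall r (h : hom r n), (N < r)%N -> efn h = 0
}.

(** Equivariance between degrees that are equal but not convertible, such as [r] and [#|himg h|]. *)
Lemma efn_eqv_iso n (x : efun n) r r' (h : hom r n) (s : hom r' r) :
  (r <= r')%N -> efn x h = act s (efn x (hcomp h s)).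
Proof.
move=> le; have e : r = r' by apply/anti_leq; rewrite le (homG_leq s).
by move: s; rewrite -{}e; apply: efn_eqv.
Qed.

Lemma efun_eq n (x y : efun n) : (forall r (h : hom r n), efn x h = efn y h) -> x = y.
Proof.
case: x y => f fe fs [g ge gs] /= e.
have {}e : f = g by apply: functional_extensionality_dep => r; apply: funext.
by move: fe fs ge gs; rewrite e => fe fs ge gs;
  rewrite (Prop_irrelevance fe ge) (Prop_irrelevance fs gs).
Qed.

HB.instance Definition _ n := gen_eqMixin (efun n).
HB.instance Definition _ n := gen_choiceMixin (efun n).

Definition efun0 n : efun n.
Proof.
refine (@Efun n (fun r _ => 0) _ _) => // r h s.
by rewrite raddf0.
Defined.

Definition efun_add n (x y : efun n) : efun n.
Proof.
refine (@Efun n (fun r h => efn x h + efn y h) _ _) => [r h s|r h lt].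
  by rewrite raddfD /= -!efn_eqv.
by rewrite !efn_supp ?addr0.
Defined.

Definition efun_opp n (x : efun n) : efun n.
Proof.
refine (@Efun n (fun r h => - efn x h) _ _) => [r h s|r h lt].
  by rewrite raddfN /= -!efn_eqv.
by rewrite !efn_supp ?oppr0.
Defined.

Definition efun_scale n (c : k) (x : efun n) : efun n.
Proof.
refine (@Efun n (fun r h => c *: efn x h) _ _) => [r h s|r h lt].
  by rewrite linearZ /= -!efn_eqv.
by rewrite !efn_supp ?scaler0.
Defined.

Fact efun_addA n : associative (@efun_add n).
Proof. by move=> x y z; apply: efun_eq => r h; apply: addrA. Qed.
Fact efun_addC n : commutative (@efun_add n).
Proof. by move=> x y; apply: efun_eq => r h; apply: addrC. Qed.
Fact efun_add0 n : left_id (@efun0 n) (@efun_add n).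
Proof. by move=> x; apply: efun_eq => r h; apply: add0r. Qed.
Fact efun_addN n : left_inverse (@efun0 n) (@efun_opp n) (@efun_add n).
Proof. by move=> x; apply: efun_eq => r h; apply: addNr. Qed.

HB.instance Definition _ n :=
  GRing.isZmodule.Build (efun n) (@efun_addA n) (@efun_addC n)
    (@efun_add0 n) (@efun_addN n).

Fact efun_scaleA n c d (x : efun n) :
  efun_scale c (efun_scale d x) = efun_scale (c * d) x.
Proof. by apply: efun_eq => r h; apply: scalerA. Qed.
Fact efun_scale1 n : left_id 1 (@efun_scale n).
Proof. by move=> x; apply: efun_eq => r h; apply: scale1r. Qed.
Fact efun_scaleDr n : right_distributive (@efun_scale n) +%R.
Proof. by move=> c x y; apply: efun_eq => r h; apply: scalerDr. Qed.
Fact efun_scaleDl n (x : efun n) : {morph (@efun_scale n)^~ x : c d / c + d}.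
Proof. by move=> c d; apply: efun_eq => r h; apply: scalerDl. Qed.

HB.instance Definition _ n :=
  GRing.Zmodule_isLmodule.Build k (efun n) (@efun_scaleA n) (@efun_scale1 n)
    (@efun_scaleDr n) (@efun_scaleDl n).

Lemma efn_sum n r (h : hom r n) I (s : seq I) P (F : I -> efun n) :
  efn (\sum_(i <- s | P i) F i) h = \sum_(i <- s | P i) efn (F i) h.
Proof. by elim/big_rec2: _ => // i x y _ <-. Qed.

(** Pushforward along [b]: [f] is transported by the injection [hcomp b] and extended by zero. *)
Definition ext0 n m (b : hom n m) (f : forall r, hom r n -> Vsp V r) r
    (h : hom r m) : Vsp V r :=
  if pselect (exists h', h = hcomp b h') is left e then f r (projT1 (cid e)) else 0.

Lemma ext0_in n m (b : hom n m) f r (h : hom r n) :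
  ext0 b f (hcomp b h) = f r h.
Proof.
rewrite /ext0; case: pselect => [e|[]]; last by exists h.
by case: cid => h' /= /hcompI <-.
Qed.

Lemma ext0_out n m (b : hom n m) f r (h : hom r m) :
  (forall h', h <> hcomp b h') -> ext0 b f h = 0.
Proof. by move=> nh; rewrite /ext0; case: pselect => // e; case: (cid e) => h' /= /nh. Qed.

Lemma hcomp_case n m (b : hom n m) r (h : hom r m) :
  (exists h', h = hcomp b h') \/ (forall h', h <> hcomp b h').
Proof.
case: (EM (exists h', h = hcomp b h')) => [|nh]; first by left.
by right=> h' e; apply: nh; exists h'.
Qed.

Definition efun_act n m (b : hom n m) (x : efun n) : efun m.
Proof.
refine (@Efun m (ext0 b (@efn n x)) _ _) => [r h s|r h lt].
  have [[h' ->]|nh] := hcomp_case b h.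
    by rewrite -hcompA !ext0_in; apply: efn_eqv.
  (* Precomposing with the invertible [s] cannot bring [h] into the image of [hcomp b]. *)
  rewrite !ext0_out ?raddf0 // => h' e; have [t st _] := hinv s (leqnn r).
  by apply: (nh (hcomp h' t)); rewrite hcompA -e -hcompA st hcomph1.
have [[h' ->]|nh] := hcomp_case b h; first by rewrite ext0_in efn_supp.
by rewrite ext0_out.
Defined.

Definition efun_mod : fimod G k.
Proof.
refine (@FIMod G k (fun n => efun n : lmodType k) efun_act _ _ _ _).
- move=> n m b c x y; apply: efun_eq => r h /=.
  have [[h' ->]|nh] := hcomp_case b h; first by rewrite !ext0_in.
  by rewrite !ext0_out // scaler0 addr0.
- by move=> n m a b [af ag] x; rewrite (homG_eq af ag).
- move=> n x; apply: efun_eq => r h /=.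
  by rewrite -[h in LHS]hcomp1h ext0_in.
- move=> n m l a b x; apply: efun_eq => r h /=.
  have [[h' ->]|nh] := hcomp_case a h; last first.
    by rewrite !ext0_out // => h'; rewrite -hcompA; apply: nh.
  rewrite ext0_in; have [[h'' ->]|nh] := hcomp_case b h'.
    by rewrite hcompA !ext0_in.
  by rewrite !ext0_out // => h''; rewrite -hcompA => /hcompI /nh.
Defined.

Lemma efun_torsion_free n m (b : hom n m) (x : Vsp efun_mod n) :
  act b x = 0 -> x = 0.
Proof.
move=> e; apply: efun_eq => r h.
by have := congr1 (fun y : efun m => efn y (hcomp b h)) e; rewrite /= ext0_in.
Qed.

(** The function representing the tensor of the identity with [v]: an isomorphism [h] goes to its
    inverse applied to [v], all else to 0. A right inverse already makes [h] an isomorphism. *)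
Definition gen_fn r (v : Vsp V r) s (h : hom s r) : Vsp V s :=
  if pselect (exists g, hcomp h g = hid G r) is left e then act (projT1 (cid e)) v
  else 0.

Lemma gen_fnE r (v : Vsp V r) s (h : hom s r) g :
  hcomp h g = hid G r -> gen_fn v h = act g v.
Proof.
rewrite /gen_fn => hg; case: pselect => [e|[]]; last by exists g.
by case: cid => g' /=; rewrite -hg => /hcompI ->.
Qed.

Lemma gen_fn0 r (v : Vsp V r) s (h : hom s r) :
  (forall g, hcomp h g <> hid G r) -> gen_fn v h = 0.
Proof. by move=> nh; rewrite /gen_fn; case: pselect => // e; case: (cid e) => g /= /nh. Qed.

Lemma section_case s r (h : hom s r) :
  (exists g, hcomp h g = hid G r) \/ (forall g, hcomp h g <> hid G r).
Proof.
case: (EM (exists g, hcomp h g = hid G r)) => [|nh]; first by left.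
by right=> g e; apply: nh; exists g.
Qed.

Definition efun_gen r (v : Vsp V r) : efun r.
Proof.
refine (@Efun r (fun s h => if (s <= N)%N then gen_fn v h else 0) _ _)
  => [s h t|s h]; last by rewrite ltnNge => /negPf ->.
case: ifP => _; last by rewrite raddf0.
have [t' tt' t't] := hinv t (leqnn s).
have [[g e]|nh] := section_case h.
  rewrite (gen_fnE _ e) (@gen_fnE _ _ _ _ (hcomp t' g)).
    by rewrite -act_comp hcompA tt' hcomp1h.
  by rewrite -hcompA [hcomp t _]hcompA tt' hcomp1h.
by rewrite !gen_fn0 ?raddf0 // => g; rewrite -hcompA; apply: nh.
Defined.

Lemma efun_gen_lin r : klinear (@efun_gen r : _ -> Vsp efun_mod r).
Proof.
move=> c x y; apply: efun_eq => s h /=; case: ifP => _; last by rewrite scaler0 addr0.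
have [[g e]|nh] := section_case h; first by rewrite !(gen_fnE _ e) linearP.
by rewrite !gen_fn0 // scaler0 addr0.
Qed.

Lemma efun_gen_act r (a : hom r r) (v : Vsp V r) :
  efun_gen (act a v) = act a (efun_gen v : Vsp efun_mod r).
Proof.
have [a' aa' a'a] := hinv a (leqnn r).
apply: efun_eq => s h /=; rewrite -[h]hcomp1h -aa' -hcompA ext0_in; case: ifP => // _.
have [[g e]|nh] := section_case (hcomp a' h).
  rewrite (gen_fnE _ e) (@gen_fnE _ _ _ _ (hcomp g a')).
    by rewrite -act_comp -hcompA a'a hcomph1.
  by rewrite -hcompA [hcomp _ (hcomp g _)]hcompA e hcomp1h.
rewrite !gen_fn0 // => g e; apply: (nh (hcomp g a)).
apply: (@hcompI _ _ _ _ a); rewrite hcomph1 -[RHS]hcomp1h -e.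
by rewrite !hcompA.
Qed.

Lemma efun_gen_at r (v : Vsp V r) : (r <= N)%N -> efn (efun_gen v) (hid G r) = v.
Proof. by move=> /= ->; rewrite (gen_fnE _ (hcomp1h (hid G r))) act_id. Qed.

Lemma efun_gen_off r (v : Vsp V r) s (h : hom s r) :
  himg h != setT -> efn (efun_gen v) h = 0.
Proof.
move=> nh /=; case: ifP => // _; apply: gen_fn0 => g e; case/negP: nh.
apply/eqP/setP => i; rewrite inE; apply/imsetP; exists (hf g i) => //.
exact: (esym (congr1 (fun a => hf a i) e)).
Qed.

(* The sum over subsets is the sum over the [G_r]-orbits of [Hom([r], [n])]. *)
Lemma efun_decomp n (x : Vsp efun_mod n) :
  x = \sum_(A : {set 'I_n}) act (hset G A) (efun_gen (efn x (hset G A)) : Vsp efun_mod _).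
Proof.
apply: efun_eq => r h; rewrite efn_sum (bigD1 (himg h)) //= big1 ?addr0.
  have [c hc] := hset_factor (subxx (himg h)).
  have [|c' cc' _] := hinv c; first by rewrite card_himg.
  rewrite [X in ext0 _ _ X]hc ext0_in; case: leqP => [le|lt]; last exact: efn_supp.
  rewrite (gen_fnE _ cc') (efn_eqv_iso _ h c') ?card_himg //.
  by rewrite [h in hcomp h _]hc -hcompA cc' hcomph1.
move=> A nA; have [[c hc]|nh] := hcomp_case (hset G A) h; last exact: ext0_out.
rewrite [h]hc ext0_in; apply: efun_gen_off; apply: contraNN nA => /eqP e.
rewrite hc himg_hcomp e -{1}(himg_hset G A); apply/eqP/setP => y.
by apply/imsetP/imsetP => -[i _ ->]; exists i.
Qed.

Lemma efun_gen_fin_deg : gen_fin_deg efun_mod.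
Proof.
exists N => W sW HW n x; rewrite [x]efun_decomp; apply: (subsum sW) => A _.
apply: (subact sW); have [le|lt] := leqP #|A| N; first exact: HW.
rewrite (efn_supp x _ lt) (klinear0 (@efun_gen_lin _)); exact: (sub0 sW).
Qed.

(** * Maps out of the free model *)

Section Eval.
Variables (U : fimod G k) (phi : forall r, Vsp V r -> Vsp U r).
Hypothesis phi_lin : forall r, klinear (@phi r).
Hypothesis phi_act : forall r (a : hom r r) v, (r <= N)%N -> phi (act a v) = act a (phi v).

Definition efun_eval n (x : Vsp efun_mod n) : Vsp U n :=
  \sum_(A : {set 'I_n}) act (hset G A) (phi (efn x (hset G A))).

(** Equivariance makes a term of [efun_eval] independent of the representative of its orbit; above
    degree [N] both sides vanish. *)
Lemma act_phi_himg n (x : Vsp efun_mod n) r (h : hom r n) A : himg h = A ->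
  act (hset G A) (phi (efn x (hset G A))) = act h (phi (efn x h)).
Proof.
move=> <-; have [c hc] := hset_factor (subxx (himg h)).
have e : r = #|himg h| by rewrite card_himg.
have [le|lt] := leqP r N; last first.
  by rewrite !efn_supp -?e // !(klinear0 (@phi_lin _)) !raddf0.
transitivity (act (hcomp (hset G (himg h)) c)
  (phi (efn x (hcomp (hset G (himg h)) c)))); last by rewrite -hc.
move: (hset G (himg h)) c {hc}; rewrite -e => g c.
by rewrite act_comp -phi_act // -efn_eqv.
Qed.

Lemma efun_eval_morph : @is_fimorph G k efun_mod U efun_eval.
Proof.
split=> [n c x y|n m a x].
  rewrite /efun_eval scaler_sumr -big_split /=; apply: eq_bigr => A _.
  by rewrite phi_lin linearP.
(* Sets not inside the image of [a] contribute 0, as [act a x] is an extension by zero; the others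
   are images of subsets of the source. *)
rewrite /efun_eval act_sum (bigID (fun A : {set 'I_m} => A \subset himg a)) /=.
rewrite [X in _ + X]big1; last first.
  move=> A nA; rewrite ext0_out ?(klinear0 (@phi_lin _)) ?raddf0 // => h e.
  case/negP: nA; rewrite -[A](himg_hset G) e himg_hcomp.
  by apply/subsetP => _ /imsetP [i _ ->]; apply: himg_in.
rewrite addr0 (reindex_onto (fun A : {set 'I_n} => hf a @: A)
  (fun A => hf a @^-1: A)) /=; last first.
  move=> A /subsetP sA; apply/setP => y; apply/imsetP/idP => [[i] |yA].
    by rewrite inE => iA ->.
  by have /imsetP [i _ e] := sA y yA; exists i; rewrite // inE -e.
rewrite (eq_bigl xpredT); last first.
  move=> A; apply/andP; split.
    by apply/subsetP => _ /imsetP [i _ ->]; apply: himg_in.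
  apply/eqP/setP => i; rewrite inE mem_imset //; exact: hf_inj.
apply: eq_bigr => A _.
have := @act_phi_himg m (act a x) _ (hcomp a (hset G A)) (hf a @: A).
by rewrite himg_hcomp himg_hset /= => -> //; rewrite ext0_in act_comp.
Qed.

Lemma efun_eval_gen r (v : Vsp V r) : (r <= N)%N -> efun_eval (efun_gen v) = phi v.
Proof.
move=> le; rewrite /efun_eval (bigD1 setT) //= big1 ?addr0.
  rewrite (@act_phi_himg r (efun_gen v) _ (hid G r) setT).
    by rewrite act_id efun_gen_at.
  by apply/setP => i; rewrite inE; apply: (himg_in (hid G r)).
move=> A nA; rewrite [X in phi X]efun_gen_off ?(klinear0 (@phi_lin _)) ?raddf0 //.
by rewrite himg_hset.
Qed.

End Eval.

Definition grmod_at r : grmod G k r :=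
  @GRMod G k r (Vsp V r) (@act _ _ V r r) (@act_lin _ _ V r r) (@act_ext _ _ V r r)
    (@act_id _ _ V r) (@act_comp _ _ V r r r).

Lemma efun_free : free_gen_le efun_mod N.
Proof.
exists 'I_N.+1, (fun i => i : nat), (fun i => grmod_at i),
  (fun i => @efun_gen i : Wsp (grmod_at i) -> Vsp efun_mod i).
split=> [i|]; first by rewrite -ltnS.
split=> [i|U phi phiP].
  by split; [exact: efun_gen_lin | move=> a w; apply: efun_gen_act].
(* [phi] is given only in degrees up to [N]; [efun_eval] expects all degrees, so it is extended by
   zero. *)
pose psi r (v : Vsp V r) : Vsp U r :=
  if boolP (r < N.+1)%N is AltTrue lt then phi (Ordinal lt) v else 0.
have psiE (i : 'I_N.+1) v : psi i v = phi i v.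
  case: i v => r lt v; rewrite /psi; case: {-}_ / boolP => [lt'|]; last by rewrite lt.
  by rewrite (bool_irrelevance lt' lt).
have psi_lin r : klinear (@psi r).
  move=> c x y; rewrite /psi; case: {-}_ / boolP => [lt|_].
    exact: (phiP (Ordinal lt)).1.
  by rewrite scaler0 addr0.
have psi_act r (a : hom r r) v : (r <= N)%N -> psi r (act a v) = act a (psi r v).
  move=> lt; pose i := Ordinal (lt : (r < N.+1)%N).
  by rewrite !(psiE i); apply: (phiP i).2.
have evalm := efun_eval_morph psi_lin psi_act.
exists (efun_eval psi); split=> //; split.
  by move=> i w; rewrite -psiE; apply: efun_eval_gen => //; rewrite -ltnS.
move=> Psi [Psi_lin Psi_act] PsiE n x.
(* Uniqueness: [x] is a sum of images of generators. *)
rewrite [in LHS](efun_decomp x) klinear_sum //; apply: eq_bigr => A _.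
rewrite Psi_act; congr (act _ _); have [lt|lt] := ltnP #|A| N.+1.
  by rewrite (psiE (Ordinal lt)) -PsiE.
by rewrite efn_supp // (klinear0 (@efun_gen_lin _)) !klinear0.
Qed.

End FreeModel.

(** * Coherence and torsion degree *)

Section Coherence.
Variables (G : groupType) (k : comPzRingType).
Implicit Type V F K : fimod G k.

(* The canonical map from [F] to the free model on [F_0, ..., F_d] is split by
   evaluation, so [F] inherits torsion-freeness from the model. *)
Lemma free_act_inj F d : free_gen_le F d ->
  forall n m (b : homG G n m), injective (act b : Vsp F n -> Vsp F m).
Proof.
move=> [I [r [W [iota [ler [iotaP univ]]]]]] n m b x y exy.
have [|Phi [PhiM [PhiE _]]] :=
    univ (efun_mod F d) (fun i w => efun_gen d (iota i w)).
  move=> i; split=> [c u v|a w]; first by rewrite (iotaP i).1 efun_gen_lin.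
  by rewrite (iotaP i).2; apply: efun_gen_act.
pose sg := efun_eval (V := F) (N := d) (U := F) (fun _ v => v).
have sgM : is_fimorph sg by apply: efun_eval_morph.
(* The identity and [sg] after [Phi] both extend [iota], so they agree. *)
have [|Th [_ [_ uniqT]]] := univ F iota; first by [].
have id_Th l z : z = Th l z by apply: (uniqT (fun _ v => v)).
have sgPhi l z : sg l (Phi l z) = z.
  rewrite [RHS]id_Th; apply: (uniqT (fun l z => sg l (Phi l z))) => [|i w].
    split=> [j c u v|j l' a u]; first by rewrite PhiM.1 sgM.1.
    by rewrite PhiM.2 sgM.2.
  by rewrite PhiE; apply: efun_eval_gen.
suff e : Phi n x = Phi n y by rewrite -(sgPhi n x) e sgPhi.
apply/eqP; rewrite -subr_eq0; apply/eqP/(@efun_torsion_free _ _ _ _ _ _ b).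
transitivity (act b (Phi n x) - act b (Phi n y)); first exact: raddfB.
by rewrite -!PhiM.2 exy subrr.
Qed.

Section Saturation.
Variables (F K : fimod G k) (i : forall n, Vsp K n -> Vsp F n).
Hypothesis F_inj : forall n m (b : homG G n m), injective (act b : Vsp F n -> Vsp F m).
Hypothesis iM : is_fimorph i.
Hypothesis i_inj : forall n, injective (@i n).

(* The elements of [K_{1 + n}] that, inside [F], do not involve the extra point:
   moving it to a fresh position has no effect. *)
Definition point_free n (z : Vsp (fishift 1 K) n) : Prop :=
  act (hinc G 1 (1 + n)) (@i (1 + n) z) = act (hshift 1 (hinc G 1 n)) (@i (1 + n) z).

(** Both maps compared in [point_free] are natural, so transition maps preserve the condition and,
    being injective on [F], also reflect it. *)
Lemma point_free_act n m (a : homG G n m) z :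
  act (hinc G 1 (1 + m)) (@i (1 + m) (act (hshift 1 a) z))
    = act (hshift 1 (hshift 1 a)) (act (hinc G 1 (1 + n)) (@i (1 + n) z)) /\
  act (hshift 1 (hinc G 1 m)) (@i (1 + m) (act (hshift 1 a) z))
    = act (hshift 1 (hshift 1 a)) (act (hshift 1 (hinc G 1 n)) (@i (1 + n) z)).
Proof.
by rewrite !iM.2 -!act_comp -!hshift_comp !hshift_hinc.
Qed.

Lemma point_free_sub : is_submodule point_free.
Proof.
split; [|split].
- by move=> n; rewrite /point_free (klinear0 (iM.1 _)) !raddf0.
- by move=> n c x y ex ey; rewrite /point_free iM.1 !act_lin ex ey.
- move=> n m a x ex; rewrite /point_free; have [-> ->] := point_free_act a x.
  by rewrite ex.
Qed.

Lemma point_free_sat n m (a : homG G n m) (x : Vsp (fishift 1 K) n) :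
  point_free (act a x) -> point_free x.
Proof.
rewrite /point_free /=; have [-> ->] := point_free_act a x.
exact: F_inj.
Qed.

(* Away from low degrees the extra point of a point-free element can be moved to
   an unused position, so point-free elements come from [K_n]. *)
Lemma point_free_descends R : gen_sub point_free R ->
  forall n (z : Vsp (fishift 1 K) n), (R < n)%N -> point_free z ->
  exists x : Vsp K n, act (hinc G 1 n) x = z.
Proof.
move=> gR n z lt pz; have sP := point_free_sub.
(* Restricting the claim to degrees above [R] makes it vacuous on the generators. *)
pose W m (y : Vsp (fishift 1 K) m) := point_free y /\
  ((R < m)%N -> exists x : Vsp K m, act (hinc G 1 m) x = y).
suff [] : W n z by move=> _; apply.
apply: (gR n z pz) => [|m y [le py]]; last by split=> //; rewrite ltnNge le.
split; [|split].
- by move=> m; split; [exact: (sub0 sP) | exists 0; rewrite raddf0].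
- move=> m c x y [px Ex] [py Ey]; split; first exact: (subP sP).
  move=> ltm; have [[u <-] [v <-]] := (Ex ltm, Ey ltm).
  by exists (c *: u + v); rewrite linearP.
- move=> m l a x [px Ex]; split=> [|ltl]; first exact: (subact sP).
  have [lem|ltm] := leqP m R; last first.
    have [u <-] := Ex ltm; exists (act a u).
    by rewrite /= -!act_comp hshift_hinc.
  (* When [a] crosses degree [R] its image misses some [b]; [c] extends [a] by sending the extra
     point to [b]. *)
  have [b ba] := @hout G m l a (leq_ltn_trans lem ltl).
  have b_inj : injective (fun _ : 'I_1 => b) by move=> u v _; rewrite !ord1.
  have [c <-] : exists c, hcomp c (hinc G 1 m) = a.
    by eexists; apply: (@hsum_hinc G 1 m l (HomG b_inj (fun=> 1%g)) a (fun _ j => ba j)).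
  (* The identity [px], pushed forward along [hshift 1 c], is the required equation. *)
  exists (act c x); apply: i_inj; rewrite /= !iM.2 -act_comp.
  by rewrite -hshift_hinc hshift_comp !act_comp px.
Qed.

(** By [hinc_factor] the morphism may be taken to be [hinc], whose added points are then removed one
    at a time. *)
Lemma saturated_above R : gen_sub point_free R ->
  forall n m (a : homG G n m) (x : Vsp F n), (R < n)%N ->
  (exists y, i y = act a x) -> exists y, i y = x.
Proof.
move=> gR n m a x lt [y ey]; have [c ca] := hinc_factor a.
have : exists y, i y = act (hinc G m n) x.
  by exists (act c y); rewrite iM.2 ey -act_comp ca.
elim: m {a c ca y ey} => [|m IH] [y ey].
  exists y; rewrite ey -[RHS]act_id; apply: act_ext.
  by split=> // j; apply: val_inj.
apply: IH; rewrite hincS act_comp in ey.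
(* Inside [F], [y] comes from a degree without the extra point, so it is point-free. *)
have [|z ez] := point_free_descends gR (z := y) (ltn_addl m lt).
  by rewrite /point_free ey -[LHS]act_comp -[RHS]act_comp hshift_hinc.
exists z; apply: (F_inj (b := hinc G 1 (m + n))).
by rewrite -ey -ez iM.2.
Qed.

End Saturation.

Lemma coherent_td_finite V : degwise_coherent V -> td_finite V.
Proof.
move=> [F [K [i [p [d [Ffree [Kgen [iM [pM [i_inj [p_surj ker_p]]]]]]]]]]].
have F_inj := free_act_inj Ffree.
have [d' gK] := gen_fin_deg_lt Kgen.
have [R gR] := gen_sub_saturated (gen_lt_fishift (b := 1) gK)
  (point_free_sub iM) (point_free_sat F_inj iM).
exists R => n [v [[m [a av0]] v0]]; rewrite leqNgt; apply/negP => lt.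
have [x px] := p_surj n v; apply: v0; rewrite -px; apply/ker_p.
(* Since [a] kills [v = p x], the element [act a x] lies in [K]. *)
apply: (saturated_above F_inj iM i_inj gR (a := a) lt).
by apply/ker_p; rewrite pM.2 px.
Qed.

Lemma td_finite_coherent V : gen_fin_deg V -> td_finite V -> degwise_coherent V.
Proof.
move=> [N gN] [t tV].
pose F := efun_mod V N; pose p := efun_eval (V := V) (N := N) (U := V) (fun _ v => v).
have pM : is_fimorph p by apply: efun_eval_morph.
pose Y n (x : Vsp F n) := p n x = 0.
have sY : is_submodule Y.
  split; [|split].
  - by move=> n; apply: klinear0 (pM.1 n).
  - by move=> n c x y ex ey; rewrite /Y pM.1 ex ey scaler0 addr0.
  - by move=> n m a x ex; rewrite /Y pM.2 ex raddf0.
have [n m a x lt Yx|R gR] := gen_sub_saturated_above (t := t) (efun_gen_fin_deg V N) sY.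
  (* If [act a x] is in the kernel, then [p x] is torsion, hence zero above degree [t]. *)
  apply/eqP; apply: contraTT lt => /eqP px0; rewrite -leqNgt; apply: tV.
  by exists (p n x); split=> //; exists m, a; rewrite -pM.2.
exists F, (submod sY), (fun n x => subval x), p, N.
split; first exact: efun_free.
split; first exact: gen_sub_submod gR.
do 2!split=> //; split=> [n|]; first exact: subval_inj.
split=> [n y|n y]; last first.
  by split=> [py|[x <-]]; [exists (Subsp (py : Y n y)) | exact: (subvalP x)].
(* Surjectivity: the image of [p] is a submodule containing all degrees up to [N]. *)
apply: (gN (fun n y => exists x, p n x = y)) => [|j v le].
  split; [|split].
  - by move=> j; exists 0; apply: klinear0 (pM.1 j).
  - by move=> j c _ _ [u <-] [v <-]; exists (c *: u + v); rewrite pM.1.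
  - by move=> j l a _ [u <-]; exists (act a u); rewrite pM.2.
by exists (efun_gen N v); apply: efun_eval_gen.
Qed.

End Coherence.

Theorem theoremA (G : groupType) (k : comPzRingType) (V : fimod G k) :
  gen_fin_deg V -> (degwise_coherent V <-> td_finite V).
Proof.
by move=> gV; split; [exact: coherent_td_finite | exact: td_finite_coherent].
Qed.
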